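(* (i) Let $n \geqslant 3$ be an integer and let $H$ be a finite group. If $\mathfrak{R}_{S_n} \simeq \mathfrak{R}_H$ (isomorphism of graphs), then $|H| = |S_n|$. (ii) Let $n \geqslant 4$ be an integer and let $H$ be a finite group. If $\mathfrak{R}_{A_n} \simeq \mathfrak{R}_H$ (isomorphism of graphs), then $|H| = |A_n|$.
   Context: $S_n$ and $A_n$ denote the symmetric and alternating groups on $\{1,\ldots,n\}$. For a finite group $G$, let $\mathcal{N}_G$ be the simple graph whose vertices are the elements of $G$, with $x, y \in G$ joined by an edge if and only if the subgroup $\langle x, y\rangle$ is not nilpotent. The non-nilpotent graph $\mathfrak{R}_G$ is the graph obtained from $\mathcal{N}_G$ by removing all isolated vertices (so it is the empty graph when $G$ is nilpotent). *)

(* Defs.v *)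
From HB Require Import structures.
From mathcomp Require Import all_boot all_fingroup all_solvable.

Set Implicit Arguments.
Unset Strict Implicit.
Unset Printing Implicit Defensive.

Local Open Scope group_scope.

Record sgraph : Type := SGraph {
  vertex :> finType;
  adj : rel vertex;
  adj_sym : symmetric adj;
  adj_irr : irreflexive adj
}.

Definition graph_iso (X Y : sgraph) : Prop :=
  exists2 f : X -> Y, bijective f & forall x y : X, adj (f x) (f y) = adj x y.

Section RemoveIsolated.

Variable X : sgraph.

Definition isolated (x : X) : bool := [forall y : X, ~~ adj x y].

Definition non_isolated : finType := {x : X | ~~ isolated x}.

Definition non_isolated_adj : rel non_isolated :=
  fun x y => adj (val x) (val y).

Fact non_isolated_adj_sym : symmetric non_isolated_adj.
Proof. by move=> x y; apply: adj_sym. Qed.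

Fact non_isolated_adj_irr : irreflexive non_isolated_adj.
Proof. by move=> x; apply: adj_irr. Qed.

Definition remove_isolated : sgraph :=
  SGraph non_isolated_adj_sym non_isolated_adj_irr.

End RemoveIsolated.

Section NonNilpotentGraph.

Variables (gT : finGroupType) (G : {group gT}).

(* [subg G] is the type of elements of G, and sgval its injection into gT. *)
Definition nonnil_adj : rel [subg G] :=
  fun x y => ~~ nilpotent <<[set sgval x; sgval y]>>.

Fact nonnil_adj_sym : symmetric nonnil_adj.
Proof. by move=> x y; rewrite /nonnil_adj setUC. Qed.

Fact nonnil_adj_irr : irreflexive nonnil_adj.
Proof.
move=> x; rewrite /nonnil_adj setUid; apply/negbF.
exact: abelian_nil (cycle_abelian _).
Qed.

Definition nonnil_graph_full : sgraph := SGraph nonnil_adj_sym nonnil_adj_irr.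

Definition nonnil_graph : sgraph := remove_isolated nonnil_graph_full.

End NonNilpotentGraph.

(* Main.v *)
Require Import Defs.
From mathcomp Require Import all_boot all_fingroup all_solvable.

Set Implicit Arguments.
Unset Strict Implicit.
Unset Printing Implicit Defensive.

Local Open Scope group_scope.

(** Write I(G) for the set of elements of G that are isolated in the
non-nilpotent graph.  The graph determines |G| - |I(G)|, and I(G) = 1 when G
is a symmetric or alternating group of the given degrees, so the point is to
deduce |I(H)| = 1 from the existence of the isomorphism.

The set I(H) (the hypercentre of H) is a subgroup, because adjoining one of
its elements to a nilpotent subgroup of H yields a nilpotent subgroup
([isol_join_nil]); the main input here is the Baer-Suzuki theorem.  The same
fact shows that x and xi have the same neighbours for i in I(H), so I(H) acts
freely by translation on each class of twins, i.e., of elements with the same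
neighbours.  Hence |I(H)| divides the size of every twin class
([dvdn_isol_twins]) of H, hence of every twin class of G consisting of
vertices of the graph.  It also divides |H| - |I(H)| = |G| - 1, so it is coprime to |G|.
It is therefore enough to exhibit in G a twin class, other than that of 1,
all of whose possible prime divisors already divide |G| ([card_eq_smooth]).

In S_n take the class of a transposition, in A_n that of a 3-cycle.  Let A be
the support of that element c.  A twin x of c generates a nilpotent group with
every y in G that is supported off A, since such a y commutes with c.  In a
nilpotent group elements of coprime orders commute, so the 3'-part of x
commutes with the 3-cycles off A, and its 3-part with the transpositions (or
double transpositions) off A; this forces both parts to fix every point
outside A, provided enough of them are available.  So the class has at most
|A|! elements, which is at most n.  With A empty the same argument shows that
I(G) = 1.

When n is too small for this (n = 3, 4 for S_n and n = 4, 5, 6 for A_n) the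
number |G| - 1 happens to be one of the primes 5, 23, 11, 59, 359, and a prime
|G| - 1 leaves only |I(H)| = 1 or |I(H)| = |G| - 1; the latter exceeds the
size of every twin class ([card_eq_prime]). *)

(** * Pairs generating a nilpotent subgroup, and the isolated elements *)

Section NilpotentPairs.

Variable gT : finGroupType.
Implicit Types (x y u v : gT) (G K L : {group gT}).

Definition conil x y := nilpotent <<[set x; y]>>.

Lemma conilC x y : conil x y = conil y x.
Proof. by rewrite /conil setUC. Qed.

Lemma conil_in K x y : nilpotent K -> x \in K -> y \in K -> conil x y.
Proof.
by move=> nilK Kx Ky; apply: nilpotentS nilK; rewrite gen_subG subUset !sub1set Kx.
Qed.

Lemma conil_commute x y : commute x y -> conil x y.
Proof.
move=> cxy; apply: (@conil_in (<[x]> <*> <[y]>)).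
- apply: abelian_nil; rewrite abelianY !cycle_abelian cent_cycle cycle_subG.
  exact/cent1P.
- by rewrite -cycle_subG joing_subl.
- by rewrite -cycle_subG joing_subr.
Qed.

Lemma mem_conil x y : (x \in <<[set x; y]>>) * (y \in <<[set x; y]>>).
Proof. by split; apply: mem_gen; rewrite !inE eqxx ?orbT. Qed.

Lemma conil_constt pi x y : conil x y -> conil x.`_pi y.
Proof.
by move/conil_in; apply; rewrite ?mem_conil // groupX ?mem_conil.
Qed.

Lemma conil_coprime_commute pi x y :
  conil x y -> pi.-elt x -> pi^'.-elt y -> commute x y.
Proof.
move=> nilxy pix piy; apply/cent1P; rewrite -cent_cycle -cycle_subG.
apply: sub_nilpotent_cent2 nilxy _ _ _; rewrite ?cycle_subG ?mem_conil //.
by rewrite coprime_sym; apply: pnat_coprime pix piy.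
Qed.

Lemma conil_pgroup pi K u v : nilpotent K -> u \in K -> v \in K ->
  pi.-elt u -> pi.-elt v -> pi.-group <<[set u; v]>>.
Proof.
move=> nilK Ku Kv piu piv; apply: pgroupS (pcore_pgroup pi K).
have hallK := nilpotent_pcore_Hall pi nilK.
by rewrite gen_subG subUset !sub1set !(mem_normal_Hall hallK) ?pcore_normal //= piu.
Qed.

(** This is the hypercentre of G. *)
Definition isol G := [set x in G | [forall y in G, conil x y]].

(** Since adjacency is the negation of [conil], twins are the elements of G with
the same neighbours. *)
Definition twins G x := [set x' in G | [forall y in G, conil x' y == conil x y]].

Lemma isolP G x :
  reflect (x \in G /\ {in G, forall y, conil x y}) (x \in isol G).
Proof.
by rewrite inE; apply: (iffP andP) => -[Gx /forall_inP h].
Qed.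

Lemma twinsP G x x' :
  reflect (x' \in G /\ {in G, conil x' =1 conil x}) (x' \in twins G x).
Proof.
rewrite inE; apply: (iffP andP) => -[Gx h]; split=> //.
  by move=> y Gy; exact: (eqP (forall_inP h y Gy)).
by apply/forall_inP=> y Gy; rewrite h.
Qed.

Lemma isol_constt pi G x : x \in isol G -> x.`_pi \in isol G.
Proof.
case/isolP=> Gx nilx; apply/isolP; split=> [|y Gy]; first exact: groupX.
by apply: conil_constt; apply: nilx.
Qed.

(** An isolated u generates a nilpotent group with each of its conjugates, so
the Baer-Suzuki criterion applies. *)
Lemma isol_pcore (p : nat) G u : p.-elt u -> u \in isol G -> u \in 'O_p(G).
Proof.
move=> pu /isolP[Gu nilu]; apply: Baer_Suzuki => // y Gy.
apply: (conil_pgroup (nilu _ (groupJ Gu Gy))); rewrite ?mem_conil //.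
by rewrite p_eltJ.
Qed.

(** Split L as O_p(L) x O_p'(L).  The first factor together with u lies in
O_p(L)O_p(G), a p-group, while the second one centralises u because u commutes
with every p'-element of G. *)
Lemma isol_p_join_nil (p : nat) G L u : p.-elt u -> u \in isol G ->
  L \subset G -> nilpotent L -> nilpotent (L <*> <[u]>).
Proof.
move=> pu Iu sLG nilL; have [Gu nilu] := isolP _ _ Iu.
have /dprodP[_ defL cL _] := nilpotent_pcoreC p nilL.
set P := 'O_p(L) in defL cL; set Q := 'O_p^'(L) in defL cL.
have cQ: Q \subset 'C(P <*> <[u]>).
  rewrite centY subsetI cL cent_cycle; apply/subsetP=> y Qy; apply/cent1P.
  apply/commute_sym/(@conil_coprime_commute p) => //.
    by apply: nilu; apply: (subsetP sLG); apply: (subsetP (pcore_sub _ _)) Qy.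
  exact: mem_p_elt (pcore_pgroup _ _) Qy.
have pPu: p.-group (P <*> <[u]>).
  have nO : P \subset 'N('O_p(G)).
    by rewrite (subset_trans (pcore_sub _ _)) // (subset_trans sLG) // gFnorm.
  have: p.-group ('O_p(G) <*> P) by rewrite norm_joinEr // pgroupM !pcore_pgroup.
  apply: pgroupS; rewrite join_subG joing_subr cycle_subG.
  exact: subsetP (joing_subl _ _) _ (isol_pcore pu Iu).
have nilM : nilpotent ((P <*> <[u]>) * Q).
  by rewrite mulg_nil // (pgroup_nil pPu) (nilpotentS (pcore_sub _ _) nilL).
rewrite -cent_joinEr // in nilM.
apply: nilpotentS nilM; rewrite join_subG -{1}defL mul_subG /=.
- by rewrite joingC joingA joing_subr.
- exact: subset_trans (joing_subl _ _) (joing_subl _ _).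
- exact: joing_subr.
Qed.

(** Adjoin the primary components of x one after the other. *)
Lemma isol_join_nil G L x :
  x \in isol G -> L \subset G -> nilpotent L -> nilpotent (L <*> <[x]>).
Proof.
move=> Ix; have [Gx _] := isolP _ _ Ix.
(* Membership in G is carried along so that each intermediate join stays in G. *)
suffices [_]: x \in G /\ forall K, K \subset G -> nilpotent K ->
  nilpotent (K <*> <[x]>) by apply.
rewrite -{1 2}(prod_constt x).
elim/big_ind: _ => [|u v [Gu nilu] [Gv nilv]|p _].
- by split=> // K _; rewrite cycle1 joingG1.
- split=> [|K sKG nilK]; first exact: groupM.
  have sMG: K <*> <[u]> \subset G by rewrite join_subG sKG cycle_subG.
  apply: nilpotentS (nilv _ sMG (nilu _ sKG nilK)).
  rewrite join_subG (subset_trans (joing_subl K <[u]>)) ?joing_subl //=.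
  rewrite cycle_subG groupM // -cycle_subG ?joing_subr //.
  exact: subset_trans (joing_subr K <[u]>) (joing_subl _ _).
- split=> [|K]; first exact: groupX.
  apply: isol_p_join_nil (p_elt_constt p x) _; exact: isol_constt.
Qed.

(** If z and y generate a nilpotent group L, then zj and y lie in the nilpotent
group generated by L and j; going back from xi to x uses the inverse of i. *)
Lemma isol_mulr_twins G x i : x \in G -> i \in isol G -> x * i \in twins G x.
Proof.
have half z y j : z \in G -> y \in G -> j \in isol G ->
    conil z y -> conil (z * j) y.
  move=> Gz Gy Ij nil_zy.
  have sG: <<[set z; y]>> \subset G.
    by rewrite gen_subG subUset !sub1set Gz.
  apply: conil_in (isol_join_nil Ij sG nil_zy) _ _.
    rewrite groupM // ?mem_gen // inE ?cycle_id ?orbT //.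
    by rewrite mem_conil.
  by rewrite mem_gen // inE mem_conil.
move=> Gx Ii; have [Gi nili] := isolP _ _ Ii.
apply/twinsP; split=> [|y Gy]; first exact: groupM.
apply/idP/idP => [nil_xiy|]; last exact: half.
rewrite -(mulgK i x) half ?groupM //.
apply/isolP; split=> [|z Gz]; first by rewrite groupV.
by apply: conil_in (nili z Gz) _ _; rewrite ?groupV mem_conil.
Qed.

(** The product ij is a twin of i, and i has no neighbours. *)
Lemma isol_group_set G : group_set (isol G).
Proof.
apply/group_setP; split=> [|i j Ii Ij].
  by apply/isolP; split=> // y _; apply/conil_commute/commute_sym/commute1.
have [[Gi nili] [Gj _]] := (isolP _ _ Ii, isolP _ _ Ij).
apply/isolP; split=> [|y Gy]; first exact: groupM.
by have /twinsP[_ ->] := isol_mulr_twins Gi Ij; last exact: Gy; apply: nili.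
Qed.

Canonical isol_group G := group (isol_group_set G).

(** Right translation by the group of isolated elements preserves a twin class
and its orbits are cosets. *)
Lemma dvdn_isol_twins G x : #|isol G| %| #|twins G x|.
Proof.
have actsT: [acts isol_group G, on twins G x | 'R].
  apply/actsP=> i Ii y.
  have sub z j : j \in isol G -> z \in twins G x -> z * j \in twins G x.
    move=> Ij /twinsP[Gz eqz].
    have /twinsP[Gzj eqzj] := isol_mulr_twins Gz Ij.
    by apply/twinsP; split=> // w Gw; rewrite eqzj ?eqz.
  apply/idP/idP => /= [Tyi|]; last exact: sub.
  by rewrite -(mulgK i y) sub // (groupVr (G := isol_group G)).
rewrite (@card_uniform_partition _ #|isol G| _ _ _ (orbit_partition actsT)).
  exact: dvdn_mull.
by move=> _ /imsetP[y _ ->]; rewrite orbitR card_lcoset.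
Qed.

Lemma isol_sub G : isol G \subset G.
Proof. by apply/subsetP=> x /isolP[]. Qed.

Lemma dvdn_isol G : #|isol G| %| #|G|.
Proof. exact: cardSg (isol_sub G). Qed.

End NilpotentPairs.

(** * The graph determines the order up to the isolated elements *)

Section GraphInvariants.

Lemma isolatedE (gT : finGroupType) (G : {group gT})
  (v : nonnil_graph_full G) : isolated v = (sgval v \in isol G).
Proof.
rewrite /isolated inE subgP /=; apply/forallP/forall_inP => [iso_v y Gy|iso_v w].
  by have := iso_v (subg G y); rewrite /= /nonnil_adj subgK // negbK.
by rewrite /= /nonnil_adj negbK; apply: iso_v (subgP w).
Qed.

Variables (gT : finGroupType) (G : {group gT}).

Definition elt (v : nonnil_graph G) : gT := sgval (val v).

Lemma elt_inj : injective elt.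
Proof. by move=> v w /subg_inj/val_inj. Qed.

Lemma adjE (v w : nonnil_graph G) : adj v w = ~~ conil (elt v) (elt w).
Proof. by []. Qed.

Lemma mem_elt v : elt v \in G :\: isol G.
Proof.
by rewrite in_setD -isolatedE (valP v) subgP.
Qed.

Lemma eltP x : x \in G :\: isol G -> exists v, x = elt v.
Proof.
rewrite in_setD => /andP[nIx Gx].
have nIv : ~~ isolated (subg G x : nonnil_graph_full G).
  by rewrite isolatedE subgK.
by exists (exist (fun v => ~~ isolated v) _ nIv); rewrite /elt subgK.
Qed.

Lemma card_nonnil_graph : #|nonnil_graph G| = (#|G| - #|isol G|)%N.
Proof.
rewrite -(setIidPr (isol_sub G)) -cardsD -(card_imset _ elt_inj).
apply: eq_card => x; apply/imsetP/idP => [[v _ ->] | /eltP[v ->]].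
  exact: mem_elt.
by exists v.
Qed.

Definition graph_twins (X : sgraph) (v : X) :=
  [set w : X | [forall u, adj w u == adj v u]].

Lemma card_graph_twins v : #|graph_twins v| = #|twins G (elt v)|.
Proof.
rewrite -(card_imset _ elt_inj); apply: eq_card => x.
have /setDP[Gv nIv] := mem_elt v.
apply/imsetP/twinsP => [[w /[1!inE]/forallP eqwv ->] | [Gx eqx]].
  have /setDP[Gw _] := mem_elt w; split=> // y Gy.
  have [Iy|nIy] := boolP (y \in isol G).
    have [_ nily] := isolP _ _ Iy.
    by rewrite !(conilC _ y) !nily.
  have /eltP[u ->] : y \in G :\: isol G by rewrite in_setD nIy.
  by apply: negb_inj; rewrite -!adjE; exact: (eqP (eqwv u)).
have /eltP[w xw] : x \in G :\: isol G.
  rewrite in_setD Gx andbT; apply: contra nIv => /isolP[_ nilx].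
  by apply/isolP; split=> // y Gy; rewrite -eqx ?nilx.
exists w => //; rewrite inE; apply/forallP=> u.
have /setDP[Gu _] := mem_elt u.
by rewrite !adjE -xw eqx.
Qed.

End GraphInvariants.

Lemma graph_iso_card (X Y : sgraph) : graph_iso X Y -> #|X| = #|Y|.
Proof. by case=> f bij_f _; apply: bij_eq_card bij_f. Qed.

Lemma graph_iso_twins (X Y : sgraph) (v : X) :
  graph_iso X Y -> exists w : Y, #|graph_twins w| = #|graph_twins v|.
Proof.
case=> f [g fK gK] adjf; exists (f v).
rewrite -(card_imset (graph_twins v) (can_inj fK)); apply: eq_card => w.
rewrite -[w]gK (mem_imset _ _ (can_inj fK)) !inE.
apply/forallP/forallP=> h u; first by have := h (f u); rewrite !adjf.
by have := h (g u); rewrite -[u]gK !adjf fK.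
Qed.

Section OrderRecovery.

Variables (gT hT : finGroupType) (G : {group gT}) (H : {group hT}).
Hypothesis isoGH : graph_iso (nonnil_graph G) (nonnil_graph H).

Lemma dvdn_isol_iso x :
  x \in G :\: isol G -> #|isol H| %| #|twins G x|.
Proof.
case/eltP=> v ->; have [w eqw] := graph_iso_twins v isoGH.
by rewrite -card_graph_twins -eqw card_graph_twins dvdn_isol_twins.
Qed.

Hypothesis isolG : isol G = 1.

Lemma card_iso : (#|G| - 1 = #|H| - #|isol H|)%N.
Proof.
rewrite -card_nonnil_graph -(graph_iso_card isoGH).
by rewrite card_nonnil_graph isolG cards1.
Qed.

Lemma card_eq_of_isol : #|isol H| = 1%N -> #|H| = #|G|.
Proof.
move=> isolH; have := card_iso; rewrite isolH !subn1.
by move=> /(congr1 succn); rewrite !prednK // cardG_gt0.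
Qed.

Lemma dvdn_isol_pred : #|isol H| %| (#|G| - 1).
Proof. by rewrite card_iso dvdn_sub ?dvdn_isol. Qed.

(** A prime divisor of |I(H)| would divide |G| by hypothesis, and it divides
|G| - 1. *)
Lemma card_eq_smooth x : x \in G -> x != 1 ->
  (forall q, prime q -> q <= #|twins G x| -> q %| #|G|) -> #|H| = #|G|.
Proof.
move=> Gx ntx smooth; apply: card_eq_of_isol; apply/eqP/idPn => isol_gt1.
have [|q pr_q q_dv] := pdivP (n := #|isol H|).
  by rewrite ltn_neqAle eq_sym isol_gt1 (cardG_gt0 (isol_group H)).
have dvT: #|isol H| %| #|twins G x|.
  by apply: dvdn_isol_iso; rewrite isolG !inE ntx.
have q_leT : q <= #|twins G x|.
  apply: dvdn_leq (dvdn_trans q_dv dvT).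
  by apply/card_gt0P; exists x; apply/twinsP.
have := dvdn_trans q_dv dvdn_isol_pred.
rewrite dvdn_subr ?cardG_gt0 ?smooth // dvdn1 => /eqP q1.
by rewrite q1 in pr_q.
Qed.

(** A twin class of a nontrivial x misses both 1 and any neighbour y of x, so
its size is less than |G| - 1 and cannot be a multiple of it. *)
Lemma card_eq_prime : prime (#|G| - 1) -> #|H| = #|G|.
Proof.
move=> pr_G; apply: card_eq_of_isol.
have G_gt1 : 1 < #|G| by rewrite -subn_gt0 prime_gt0.
have [_ /(_ _ dvdn_isol_pred)/orP[/eqP//|/eqP eqz]] := primeP pr_G.
have /trivgPn[x Gx ntx] : G :!=: 1 by rewrite trivg_card1 neq_ltn G_gt1 orbT.
have nIx : x \in G :\: isol G by rewrite isolG !inE ntx.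
have /existsP[y /andP[Gy nil'xy]] : [exists y in G, ~~ conil x y].
  by move: nIx; rewrite !inE Gx negb_forall_in andbT.
have nil1y : conil 1 y by apply/conil_commute/commute_sym/commute1.
have y_neq1: y != 1.
  by apply: contraNneq nil'xy => ->; apply/conil_commute/commute1.
have sTG : twins G x \subset G :\ 1 :\ y.
  apply/subsetP=> x' /twinsP[Gx' eqx']; rewrite !inE Gx' andbT.
  rewrite -eqx' // in nil'xy.
  apply/andP; split; apply: contraNneq nil'xy => -> //.
  exact/conil_commute.
have := subset_leq_card sTG; rewrite leqNgt => /negP[].
have := cardsD1 1 G; rewrite group1 (cardsD1 y (G :\ 1)) !inE y_neq1 Gy => cG.
apply: (@leq_trans #|isol H|); last first.
  apply: dvdn_leq (dvdn_isol_iso nIx).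
  by apply/card_gt0P; exists x; apply/twinsP.
by rewrite eqz cG.
Qed.

End OrderRecovery.

(** * Permutations commuting with short cycles *)

Section PermutationFixedPoints.

Variable T : finType.
Implicit Types (x y : {perm T}) (A S : {set T}) (a b d e : T).

Lemma commute_permE x y a : commute x y -> x (y a) = y (x a).
Proof. by move=> cxy; rewrite -!permM cxy. Qed.

Lemma commute_moved S x y a :
  commute x y -> perm_on S y -> y a != a -> x a \in S.
Proof.
move=> cxy yS ya; apply: (subsetP yS); rewrite inE.
by rewrite -commute_permE // (inj_eq perm_inj).
Qed.

Lemma coprime_expg_fix x k a : coprime #[x] k -> (x ^+ k) a = a -> x a = a.
Proof.
rewrite -generator_coprime => /eqP gen_xk fix_xk.
have: x \in <[x ^+ k]> by rewrite -gen_xk cycle_id.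
by case/cycleP=> m ->; apply: permX_fix.
Qed.

(** If x and y commute and x maps a inside the y-orbit of a, then x acts on that
orbit as a power of y, hence trivially when the orders are coprime. *)
Lemma commute_coprime_fix x y a j : commute x y -> coprime #[x] #[y] ->
  x a = (y ^+ j) a -> x a = a.
Proof.
move=> cxy co_xy xa.
have xka k : (x ^+ k) a = (y ^+ (j * k)) a.
  elim: k => [|k IHk]; first by rewrite muln0.
  rewrite expgS permM xa mulnS addnC expgD permM -IHk.
  by rewrite -!permM; congr (fun_of_perm _ a); apply/commuteX2/commute_sym.
apply: (coprime_expg_fix co_xy).
by rewrite xka mulnC expgM expg_order expg1n perm1.
Qed.

Lemma tperm_fix x a b : a != b -> 2^'.-elt x -> commute x (tperm a b) -> x a = a.
Proof.
move=> ab x2 cxy; have y2: tperm a b ^+ 2 = 1 by rewrite expgS expg1 tperm2.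
have co : coprime #[x] #[tperm a b].
  apply: (@coprime_dvdr _ 2); first by rewrite order_dvdn y2.
  by rewrite coprime_sym; apply: pnat_coprime x2.
have := commute_moved cxy (tperm_on a b).
move/(_ a); rewrite tpermL eq_sym ab !inE => /(_ isT)/orP[/eqP// | /eqP xa].
by apply: (commute_coprime_fix (j := 1)) cxy co _; rewrite expg1 tpermL.
Qed.

(** The cycle (a b d): products of permutations act left factor first. *)
Definition cyc3 a b d := tperm a b * tperm a d.

Section Three.
Variables a b d : T.
Hypothesis uabd : uniq [:: a; b; d].

Lemma cyc3E : (cyc3 a b d a = b) * (cyc3 a b d b = d) * (cyc3 a b d d = a).
Proof.
move: uabd; rewrite /= !inE negb_or andbT => /andP[/andP[ab ad] bd].
rewrite /cyc3 !permM tpermL (tpermR a b) tpermL (@tpermD _ a b d) // tpermR.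
by rewrite tpermD // eq_sym.
Qed.

Lemma cyc3_on : perm_on [set a; b; d] (cyc3 a b d).
Proof.
apply: perm_onM; apply: subset_trans (tperm_on _ _) _; apply/subsetP=> z.
  by rewrite !inE => ->.
by rewrite !inE => /orP[]->; rewrite ?orbT.
Qed.

Lemma cyc3_expg3 : cyc3 a b d ^+ 3 = 1.
Proof.
apply/permP=> z; rewrite permX perm1 /=.
have [|nz] := boolP (z \in [set a; b; d]).
  by rewrite !inE => /orP[/orP[]|] /eqP->; rewrite !cyc3E.
by rewrite !(out_perm cyc3_on nz).
Qed.

Lemma cyc3_3elt : 3.-elt (cyc3 a b d).
Proof. by apply: (@pnat_dvd _ 3) => //; rewrite order_dvdn cyc3_expg3. Qed.

Lemma odd_cyc3 : odd_perm (cyc3 a b d) = false.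
Proof.
move: uabd; rewrite /= !inE negb_or andbT => /andP[/andP[ab ad] _].
by rewrite odd_permM !odd_tperm ab ad.
Qed.

Lemma cyc3_fix x : 3^'.-elt x -> commute x (cyc3 a b d) -> x a = a.
Proof.
move=> x3 cxy; have co : coprime #[x] #[cyc3 a b d].
  by rewrite coprime_sym; apply: pnat_coprime cyc3_3elt x3.
have ab : b != a by move: uabd; rewrite /= !inE negb_or eq_sym; case: eqP.
have := commute_moved cxy cyc3_on (a := a); rewrite cyc3E ab !inE.
case/(_ isT)/orP=> [/orP[]|]/eqP xa //.
  by apply: (commute_coprime_fix (j := 1)) cxy co _; rewrite expg1 cyc3E.
apply: (commute_coprime_fix (j := 2)) cxy co _.
by rewrite permX /= !cyc3E.
Qed.
End Three.

Section Four.
Variables a b d e : T.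
Hypothesis uabde : uniq [:: a; b; d; e].
Let y := tperm a b * tperm d e.

Lemma dtpermE : (y a = b) * (y b = a) * (y d = e) * (y e = d).
Proof.
move: uabde; rewrite /= !inE !negb_or andbT.
move=> /andP[/and3P[ab ad ae] /andP[/andP[bd be] de]].
rewrite /y !permM tpermL (tpermR a b) !(@tpermD _ a b) // tpermL tpermR.
by rewrite !tpermD // eq_sym.
Qed.

Lemma dtperm_on : perm_on [set a; b; d; e] y.
Proof.
apply: perm_onM; apply: subset_trans (tperm_on _ _) _; apply/subsetP=> z.
  by rewrite !inE => ->.
by rewrite !inE => /orP[]->; rewrite ?orbT.
Qed.

Lemma dtperm_expg2 : y ^+ 2 = 1.
Proof.
apply/permP=> z; rewrite permX perm1 /=.
have [|nz] := boolP (z \in [set a; b; d; e]).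
  by rewrite !inE => /orP[/orP[/orP[]|]|] /eqP->; rewrite !dtpermE.
by rewrite !(out_perm dtperm_on nz).
Qed.

Lemma dtperm_2elt : 2.-elt y.
Proof. by apply: (@pnat_dvd _ 2) => //; rewrite order_dvdn dtperm_expg2. Qed.

Lemma odd_dtperm : odd_perm y = false.
Proof.
move: uabde; rewrite /= !inE !negb_or andbT.
move=> /andP[/and3P[ab _ _] /andP[_ de]].
by rewrite odd_permM !odd_tperm ab de.
Qed.

(** If x does not keep a in the y-orbit {a, b}, it exchanges that orbit with
{d, e}; then its square, which generates the same group as x, preserves
{a, b}. *)
Lemma dtperm_fix x : 2^'.-elt x -> commute x y -> x a = a.
Proof.
move=> x2 cxy.
have ab : b != a by move: uabde; rewrite /= !inE negb_or eq_sym; case: eqP.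
have fix_near z : 2^'.-elt z -> commute z y -> z a \in [set a; b] -> z a = a.
  move=> z2 czy; rewrite !inE => /orP[]/eqP za //.
  have co : coprime #[z] #[y].
    by rewrite coprime_sym; apply: pnat_coprime dtperm_2elt z2.
  by apply: (commute_coprime_fix (j := 1)) czy co _; rewrite expg1 dtpermE.
have [xa|nxa] := boolP (x a \in [set a; b]); first exact: fix_near.
have xb : x b = y (x a) by rewrite -commute_permE // dtpermE.
have cx2y : commute (x ^+ 2) y by apply/commute_sym/commuteX/commute_sym.
have x2a : (x ^+ 2) a = x (x a) by rewrite permX.
have Sxa : x a \in [set a; b; d; e].
  by apply: commute_moved cxy dtperm_on _; rewrite dtpermE.
have Sx2a : (x ^+ 2) a \in [set a; b; d; e].
  by apply: commute_moved cx2y dtperm_on _; rewrite dtpermE.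
apply: (@coprime_expg_fix _ 2).
  by rewrite coprime_sym; apply: pnat_coprime x2.
apply: fix_near => //; first exact: p_eltX.
have nxxa : x (x a) != x a.
  by apply: contraNneq nxa => /perm_inj->; rewrite !inE eqxx.
have nxxb : x (x a) != y (x a).
  by rewrite -xb; apply: contraNneq nxa => /perm_inj->; rewrite !inE eqxx orbT.
move: Sxa nxa nxxa nxxb Sx2a; rewrite x2a !inE -!orbA.
by case/or4P=> /eqP->; rewrite ?eqxx ?orbT // dtpermE => _ /negPf-> /negPf->;
  rewrite ?orbF.
Qed.

End Four.

End PermutationFixedPoints.

(** * Locating the support of a permutation through nilpotent pairs *)

Section Supports.

Variable T : finType.
Implicit Types (x y : {perm T}) (A S : {set T}) (a b d e : T).

Lemma uniq_extend S a n : a \in S -> n < #|S| ->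
  exists s : seq T, [/\ size s = n, uniq (a :: s) & {subset a :: s <= S}].
Proof.
move=> Sa lt_nS; exists (take n (enum (S :\ a))).
have sub : {subset take n (enum (S :\ a)) <= S :\ a}.
  by move=> z /mem_take; rewrite mem_enum.
split.
- rewrite size_takel // -cardE.
  by move: lt_nS; rewrite (cardsD1 a S) Sa.
- rewrite /= take_uniq ?enum_uniq // andbT.
  by apply/negP=> /sub; rewrite !inE eqxx.
- by move=> z; rewrite inE => /predU1P[->//|/sub/setD1P[]].
Qed.

Lemma perm_on_fixed A x : {in ~: A, forall a, x a = a} -> perm_on A x.
Proof.
move=> fix_x; apply/subsetP=> a; rewrite inE; apply: contraR => nAa.
by rewrite fix_x ?eqxx // inE.
Qed.

Lemma consttC_fix (pi : nat_pred) x a : x.`_pi a = a -> x.`_pi^' a = a -> x a = a.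
Proof. by move=> f1 f2; rewrite -{1}(consttC pi x) permM f1. Qed.

Lemma constt3_2'elt x : 2^'.-elt x.`_3.
Proof. by apply: sub_p_elt (p_elt_constt 3 x) => q /eqP->. Qed.

Lemma conil_cyc3_fix x a b d :
  uniq [:: a; b; d] -> conil x (cyc3 a b d) -> x.`_3^' a = a.
Proof.
move=> uabd nilx; apply: (cyc3_fix uabd); first exact: p_elt_constt.
apply/commute_sym/(@conil_coprime_commute _ 3); rewrite ?cyc3_3elt ?p_elt_constt //.
by rewrite conilC; apply: conil_constt.
Qed.

Lemma conil_2elt_commute x y : conil x y -> 2.-elt y -> commute x.`_3 y.
Proof.
move=> nilx y2; apply: (@conil_coprime_commute _ 3).
- exact: conil_constt.
- exact: p_elt_constt.
- by apply: sub_p_elt y2 => q /eqP->.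
Qed.

(** Three points off A suffice for a 3-cycle through a given point, which fixes
the 3'-part of x there; a transposition takes care of the 3-part. *)
Lemma Sym_support A x : 3 <= #|~: A| ->
  {in 'Sym_T, forall y, perm_on (~: A) y -> conil x y} -> perm_on A x.
Proof.
move=> A3 nilx; apply: perm_on_fixed => a Aa.
have [s []] := uniq_extend Aa A3; case: s => [|b [|d []]] // _ uabd sA.
have ab : a != b by move: uabd; rewrite /= !inE negb_or; case: eqP.
apply: (@consttC_fix 3).
  apply: (tperm_fix ab); first exact: constt3_2'elt.
  apply: conil_2elt_commute; last first.
    by apply: (@pnat_dvd _ 2) => //; rewrite order_dvdn expgS expg1 tperm2.
  apply: nilx; rewrite ?inE //.
  apply: subset_trans (tperm_on a b) _; apply/subsetP=> z.
  by rewrite !inE => /pred2P[]->; rewrite -in_setC sA // !inE eqxx ?orbT.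
apply: (conil_cyc3_fix uabd); apply: nilx; rewrite ?inE //.
apply: subset_trans (cyc3_on a b d) _; apply/subsetP=> z.
by move=> zs; apply: sA; move: zs; rewrite !inE !orbA.
Qed.

(** As for the symmetric group, with double transpositions, which are even, in
place of transpositions; this costs a fourth point off A. *)
Lemma Alt_support A x : 4 <= #|~: A| ->
  {in 'Alt_T, forall y, perm_on (~: A) y -> conil x y} -> perm_on A x.
Proof.
move=> A4 nilx; apply: perm_on_fixed => a Aa.
have [s []] := uniq_extend Aa A4; case: s => [|b [|d [|e []]]] // _ uabde sA.
have uabd : uniq [:: a; b; d] by apply: (take_uniq 3) uabde.
apply: (@consttC_fix 3).
  apply: (dtperm_fix uabde); first exact: constt3_2'elt.
  apply: conil_2elt_commute (dtperm_2elt uabde).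
  apply: nilx; rewrite ?Alt_even ?odd_dtperm //.
  apply: subset_trans (dtperm_on a b d e) _; apply/subsetP=> z.
  by move=> zs; apply: sA; move: zs; rewrite !inE !orbA.
apply: (conil_cyc3_fix uabd); apply: nilx; rewrite ?Alt_even ?odd_cyc3 //.
apply: subset_trans (cyc3_on a b d) _; apply/subsetP=> z.
by move=> zs; apply: sA; move: zs; rewrite !inE !orbA => ->.
Qed.

Lemma isol_support0 (G : {group {perm T}}) :
  (forall x, {in G, forall y, perm_on (~: set0) y -> conil x y} ->
     perm_on set0 x) -> isol G = 1.
Proof.
move=> suppG; apply/trivgP/subsetP=> x /isolP[_ nilx]; rewrite inE.
apply/eqP/(@perm_on_id _ _ set0); rewrite ?cards0 //.
by apply: suppG => y Gy _; apply: nilx.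
Qed.

(** Permutations supported off A commute with c, so they generate a nilpotent
group with c, hence with every twin of c. *)
Lemma card_twins_support (G : {group {perm T}}) A c :
  (forall x, {in G, forall y, perm_on (~: A) y -> conil x y} -> perm_on A x) ->
  perm_on A c -> #|twins G c| <= #|A|`!.
Proof.
move=> suppG Ac; rewrite -card_perm; apply/subset_leq_card/subsetP=> x.
case/twinsP=> _ eqx; apply: suppG => y Gy Ay; rewrite eqx //.
apply: conil_commute; apply: perm_onC Ac Ay _.
by rewrite -setI_eq0 setICr.
Qed.

End Supports.

(** * Symmetric and alternating groups *)

Section Degrees.

Variables (n : nat) (hT : finGroupType) (H : {group hT}).

Lemma uniq_ords k : k <= n -> exists s : seq 'I_n, size s = k /\ uniq s.
Proof.
move=> le_kn; exists (take k (enum 'I_n)).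
by rewrite size_takel ?size_enum_ord // take_uniq ?enum_uniq.
Qed.

Lemma card_ord_setC (A : {set 'I_n}) : #|~: A| = (n - #|A|)%N.
Proof. by rewrite cardsCs setCK card_ord. Qed.

Lemma Sym_order : 3 <= n ->
  graph_iso (nonnil_graph 'Sym_('I_n)) (nonnil_graph H) ->
  #|H| = #|'Sym_('I_n)|.
Proof.
move=> n3 isoH.
have isol1 : isol 'Sym_('I_n) = 1.
  by apply: isol_support0 => x; apply: Sym_support; rewrite setC0 cardsT card_ord.
have cardS : #|'Sym_('I_n)| = n`! by rewrite card_Sym card_ord.
have [n5|n_lt5] := leqP 5 n; last first.
  (* |S_n| - 1 is 5 or 23. *)
  apply: (card_eq_prime isoH isol1); rewrite cardS.
  by case: n n3 n_lt5 => [|[|[|[|[|]]]]].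
have [s []] := uniq_ords (leq_trans (isT : 2 <= 5) n5).
case: s => [|a [|b []]] // _; rewrite /= inE andbT => ab.
have nt_ab : tperm a b != 1.
  by apply: contraNneq ab => /permP/(_ a); rewrite tpermL perm1 => ->.
apply: (card_eq_smooth isoH isol1 _ nt_ab); first by rewrite inE.
move=> q pr_q; rewrite cardS => le_qT.
have card2 : #|[set a; b]| = 2 by rewrite cards2 ab.
apply: dvdn_fact; rewrite prime_gt0 //=; apply: leq_trans (leq_trans _ n5) => //.
apply: leq_trans le_qT _.
apply: leq_trans (card_twins_support _ (tperm_on a b)) _; last by rewrite card2.
by move=> x; apply: Sym_support; rewrite card_ord_setC card2 leq_subRL // ltnW.
Qed.

Lemma Alt_order : 4 <= n ->
  graph_iso (nonnil_graph 'Alt_('I_n)) (nonnil_graph H) ->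
  #|H| = #|'Alt_('I_n)|.
Proof.
move=> n4 isoH.
have isol1 : isol 'Alt_('I_n) = 1.
  by apply: isol_support0 => x; apply: Alt_support; rewrite setC0 cardsT card_ord.
have cardA : (2 * #|'Alt_('I_n)|)%N = n`!.
  by rewrite card_Alt card_ord // (leq_trans _ n4).
have [n7|n_lt7] := leqP 7 n; last first.
  have cardA_half : #|'Alt_('I_n)| = n`!./2 by rewrite -cardA mul2n doubleK.
  (* |A_n| - 1 is 11, 59 or 359. *)
  apply: (card_eq_prime isoH isol1); rewrite cardA_half.
  by case: n n4 n_lt7 => [|[|[|[|[|[|[|]]]]]]].
have [s []] := uniq_ords (leq_trans (isT : 3 <= 7) n7).
case: s => [|a [|b [|d []]]] // _ uabd.
have card3 : #|[set a; b; d]| = 3.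
  have -> : [set a; b; d] = [set z in [:: a; b; d]].
    by apply/setP=> z; rewrite !inE orbA.
  by rewrite cardsE (card_uniqP uabd).
have nt_abd : cyc3 a b d != 1.
  apply: (contraTneq _ uabd) => /permP/(_ a).
  by rewrite cyc3E // perm1 => ->; rewrite /= inE eqxx.
apply: (card_eq_smooth isoH isol1 _ nt_abd); first by rewrite Alt_even odd_cyc3.
move=> q pr_q le_qT.
have le_q6 : q <= 6.
  apply: leq_trans le_qT _.
  apply: leq_trans (card_twins_support _ (cyc3_on a b d)) _; last by rewrite card3.
  by move=> x; apply: Alt_support; rewrite card_ord_setC card3 leq_subRL // ltnW.
(* The order of A_n is n!/2: it is even since 4 divides n!, and its odd prime
   divisors are those of n!. *)
have [->|q_neq2] := eqVneq q 2.
  by rewrite -(@dvdn_pmul2l 2) // cardA dvdn_fact // ltnW // ltnW.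
have co_q2 : coprime q 2 by rewrite prime_coprime // dvdn_prime2.
rewrite -(Gauss_dvdr _ co_q2) cardA dvdn_fact // prime_gt0 //=.
exact: leq_trans le_q6 (ltnW n7).
Qed.

End Degrees.

Theorem theorem3p2 :
  (forall (n : nat) (hT : finGroupType) (H : {group hT}),
     3 <= n ->
     graph_iso (nonnil_graph 'Sym_('I_n)) (nonnil_graph H) ->
     #|H| = #|'Sym_('I_n)|)
  /\
  (forall (n : nat) (hT : finGroupType) (H : {group hT}),
     4 <= n ->
     graph_iso (nonnil_graph 'Alt_('I_n)) (nonnil_graph H) ->
     #|H| = #|'Alt_('I_n)|).
Proof. by split=> n hT H; [apply: Sym_order | apply: Alt_order]. Qed.
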